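(* For each nonnegative integer $k$, the restriction of $\mathrm{DL}_k$ to $\mathcal U_{2k+1}(231,312)$ is a bijection from $\mathcal U_{2k+1}(231,312)$ to $\mathrm{Int}(\mathcal A_k)=\{(\Lambda,\Lambda):\Lambda\in\mathbf D_k\}$. Hence $|\mathcal U_{2k+1}(231,312)|=C_k=\frac{1}{k+1}\binom{2k}{k}$.
   Context: Permutations are finite words of distinct positive integers; $S_n$ is the set of permutations of $[n]$. The stack-sorting map $s$: $s(\text{empty})=\text{empty}$, and if $\pi=LnR$ with $n$ the largest entry, $s(\pi)=s(L)s(R)n$. $\pi$ is uniquely sorted if it has exactly one preimage under $s$. A permutation avoids $\tau$ if no subsequence has the same relative order as $\tau$; $\mathcal U_n(\tau^{(1)},\dots)$ is the set of uniquely sorted permutations in $S_n$ avoiding the listed patterns. A descent of $\pi$ is an index $i$ with $\pi_i>\pi_{i+1}$; $\mathrm{Des}(\pi)$ is the set of descents. $\mathrm{rot}(\pi)=\mathrm{rev}(\pi^{-1})$, where $\mathrm{rev}$ reverses the word and $\pi^{-1}$ is the group inverse. $\mathbf D_k$ is the set of Dyck paths of semilength $k$ (words in $\{U,D\}$ with $k$ of each letter, every prefix having at least as many $U$'s as $D$'s); $\mathcal A_k$ is the antichain on $\mathbf D_k$, and $\mathrm{Int}(P)$ is the set of pairs $(x,y)$ with $x\le y$ in $P$. For $\pi\in\mathcal U_{2k+1}(312)$, $n=2k+1$, let $\Lambda_i=D$ if $n-i\in\mathrm{Des}(\pi)$ and $U$ otherwise, $\Lambda'_i=U$ if $i\in\mathrm{Des}(\mathrm{rot}(\pi))$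 and $D$ otherwise ($1\le i\le 2k$), and $\mathrm{DL}_k(\pi)=(\Lambda_1\cdots\Lambda_{2k},\Lambda'_1\cdots\Lambda'_{2k})$. *)

(* Defs.v *)
From HB Require Import structures.
From mathcomp Require Import all_boot all_fingroup all_algebra.
From mathcomp Require Import boolp classical_sets functions.

Set Implicit Arguments.
Unset Strict Implicit.
Unset Printing Implicit Defensive.

Local Open Scope classical_set_scope.
Local Open Scope nat_scope.

Definition is_permutation (w : seq nat) : bool :=
  uniq w && all (fun x => 0 < x) w.

(* One-line notation p(1) ... p(n) of p in S_n; an element i of 'I_n stands
   for i + 1. *)
Definition word (n : nat) (p : 'S_n) : seq nat :=
  [seq (nat_of_ord (p i)).+1 | i <- enum 'I_n].

(* [m] is recursion fuel, for which the length of [w] suffices; the equations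
   [stack_sort_nil] and [stack_sort_max] characterize [stack_sort]. *)
Fixpoint stack_sort_rec (m : nat) (w : seq nat) : seq nat :=
  if m is m'.+1 then
    if w is [::] then [::] else
    let a := \max_(x <- w) x in
    let i := index a w in
    stack_sort_rec m' (take i w) ++ stack_sort_rec m' (drop i.+1 w) ++ [:: a]
  else [::].

Definition stack_sort (w : seq nat) : seq nat := stack_sort_rec (size w) w.

Lemma max_mem (x : nat) (v : seq nat) : \max_(y <- x :: v) y \in x :: v.
Proof.
elim: v x => [|z v IH] x; first by rewrite big_seq1 mem_seq1.
rewrite big_cons inE /maxn; case: ifP => _; last by rewrite eqxx.
by rewrite IH orbT.
Qed.

Lemma stack_sort_rec_fuel (m : nat) (w : seq nat) :
  size w <= m -> stack_sort_rec m w = stack_sort w.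
Proof.
have H m1 : forall m2 v, size v <= m1 -> size v <= m2 ->
    stack_sort_rec m1 v = stack_sort_rec m2 v.
  elim: m1 => [|m1 IH] [|m2] [|x v] //; rewrite [size _]/= !ltnS => h1 h2.
  have hi : index (\max_(y <- x :: v) y) (x :: v) <= size v.
    by rewrite -ltnS -[(size v).+1]/(size (x :: v)) index_mem max_mem.
  have ht i : i <= size v -> size (take i (x :: v)) <= size v.
    by move=> le_iv; rewrite size_take_min (leq_trans (geq_minl _ _)).
  have hd i : size (drop i.+1 (x :: v)) <= size v.
    by rewrite size_drop /= subSS leq_subr.
  rewrite [LHS]/= [RHS]/=; congr (_ ++ (_ ++ _)); apply: IH.
  - exact: leq_trans (ht _ hi) h1.
  - exact: leq_trans (ht _ hi) h2.
  - exact: leq_trans (hd _) h1.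
  - exact: leq_trans (hd _) h2.
by move=> le_wm; apply: H.
Qed.

Lemma stack_sort_nil : stack_sort [::] = [::].
Proof. by []. Qed.

Lemma stack_sort_max (a : nat) (L R : seq nat) :
  all (fun x => x < a) L -> all (fun x => x < a) R ->
  stack_sort (L ++ a :: R) = stack_sort L ++ stack_sort R ++ [:: a].
Proof.
move=> ltL ltR; have maxE : \max_(x <- L ++ a :: R) x = a.
  apply/eqP; rewrite eqn_leq big_cat big_cons !geq_max leqnn /=.
  rewrite !leq_max leqnn orbT andbT.
  apply/andP; split; apply/bigmax_leqP_seq => x xin _; apply: ltnW.
    exact: (allP ltL).
  exact: (allP ltR).
have indE : index a (L ++ a :: R) = size L.
  have aL : a \notin L by apply/negP => /(allP ltL); rewrite ltnn.
  by rewrite index_cat (negbTE aL) /= eqxx addn0.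
have fuelE : size (L ++ a :: R) = (size L + size R).+1.
  by rewrite size_cat /= addnS.
have recE m w : w != [::] -> stack_sort_rec m.+1 w =
    stack_sort_rec m (take (index (\max_(x <- w) x) w) w) ++
    stack_sort_rec m (drop (index (\max_(x <- w) x) w).+1 w) ++
    [:: \max_(x <- w) x].
  by case: w.
rewrite {1}/stack_sort fuelE recE; last by rewrite -size_eq0 fuelE.
have dropE : drop (size L).+1 (L ++ a :: R) = R.
  by rewrite -cat_rcons drop_size_cat ?size_rcons.
rewrite maxE indE take_size_cat // dropE.
by rewrite !stack_sort_rec_fuel ?leq_addr ?leq_addl.
Qed.

Definition uniquely_sorted (w : seq nat) : Prop :=
  exists! v : seq nat, is_permutation v /\ stack_sort v = w.

Definition same_relative_order (u v : seq nat) : Prop :=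
  size u = size v /\
  forall i j : nat, i < size u -> j < size u ->
    (nth 0 u i < nth 0 u j) = (nth 0 v i < nth 0 v j).

Definition avoids (w t : seq nat) : Prop :=
  ~ exists2 u : seq nat, subseq u w & same_relative_order u t.

Definition uniquely_sorted_avoiding (n : nat) (ts : seq (seq nat)) : set 'S_n :=
  [set p | uniquely_sorted (word p) /\
           forall t : seq nat, t \in ts -> avoids (word p) t].
Arguments uniquely_sorted_avoiding : clear implicits.

(* Positions are 1-based, whereas [nth] is 0-based. *)
Definition Des (w : seq nat) : pred nat :=
  [pred i | [&& 0 < i, i < size w & nth 0 w i < nth 0 w i.-1]].

Definition rot_word (n : nat) (p : 'S_n) : seq nat := rev (word p^-1%g).

Inductive step : Type := U | D.

Definition is_U (s : step) : bool := if s is U then true else false.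
Definition step_of_bool (b : bool) : step := if b then U else D.
Lemma is_UK : cancel is_U step_of_bool. Proof. by case. Qed.
HB.instance Definition _ := Equality.copy step (can_type is_UK).

Definition dyck (k : nat) : set (seq step) :=
  [set w | [/\ count_mem U w = k, count_mem D w = k &
    forall j : nat, count_mem D (take j w) <= count_mem U (take j w)]].

(* A poset is given by its carrier [P] and its order relation [le]. *)
Definition Int (T : Type) (P : set T) (le : T -> T -> Prop) : set (T * T) :=
  [set xy | [/\ P xy.1, P xy.2 & le xy.1 xy.2]].

Definition antichain_le (T : Type) (x y : T) : Prop := x = y.

(* DL_k, extended to all of S_(2k+1) by the same formula. *)
Definition DL (k : nat) (p : 'S_(2 * k).+1) : seq step * seq step :=
  ([seq (if ((2 * k).+1 - i) \in Des (word p) then D else U)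
      | i <- iota 1 (2 * k)],
   [seq (if i \in Des (rot_word p) then U else D)
      | i <- iota 1 (2 * k)]).

(* Main.v *)
(** Record ascents as U and descents as D, reading a word [w] from right to left;
    this profile is the first component of DL. If [v = L a R] with [a] maximal and [L],
    [R] nonempty, the profile of [s(v) = s(L) s(R) a] is
    [U profile(s(R)) x profile(s(L))], where [x] is the step between [s(L)] and [s(R)];
    the profile of a sorted permutation never goes below height 0, so when it is a
    Dyck path this is its first-return decomposition, which determines [v].
    When it is not a Dyck path, some node of the decreasing tree of [v] has a
    single child or gives [x = U], and a second preimage can be built. Conversely
    a Dyck path together with 312-avoidance yields a preimage by first returns.

    A permutation avoiding 231 and 312 is layered, i.e. obtained from the
    identity by reversing consecutive blocks: it is an involution determined by
    its descents, and every set of descents occurs. Being an involution makes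
    [rot] the reversal, whence both components of DL agree. *)
Require Import Defs.
From mathcomp Require Import all_boot all_fingroup all_algebra.
From mathcomp Require Import boolp classical_sets functions.
From mathcomp Require Import zify.

Local Open Scope classical_set_scope.
Local Open Scope nat_scope.

(** * Lattice paths and first returns *)

(** [None] records a step below height 0, so [walk 0 w = Some 0] says that [w] is a Dyck path. *)
Fixpoint walk (h : nat) (w : seq step) : option nat :=
  match w with
  | [::] => Some h
  | U :: w' => walk h.+1 w'
  | D :: w' => if h is h'.+1 then walk h' w' else None
  end.

Lemma walk_cat h A B :
  walk h (A ++ B) = if walk h A is Some e then walk e B else None.
Proof. by elim: A h => [|[] A IH] [|h] //=. Qed.

Lemma walk_add c h e A : walk h A = Some e -> walk (h + c) A = Some (e + c).
Proof.
elim: A h => [|[] A IH] h /=; first by case=> ->.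
  by move=> /IH.
by case: h => //= h /IH.
Qed.

(** A leading [U] leaves two levels to descend, so the induction hypothesis is used twice in
    succession. The second use concerns a suffix of unknown length, hence the induction on size. *)
Lemma walk_first_return h w : walk h.+1 w = Some 0 ->
  exists A B, [/\ w = A ++ D :: B, walk 0 A = Some 0 & walk h B = Some 0].
Proof.
have [m] := ubnP (size w); elim: m h w => // m IH h [|[] w] //= sz.
  move=> /(IH h.+1) [//|A1 [B1 [wE A1E B1E]]].
  case: (IH h B1 _ B1E) => [|A2 [B2 [B1E' A2E B2E]]].
    by move: sz; rewrite wE size_cat /=; lia.
  exists (U :: A1 ++ D :: A2), B2; split => //.
    by rewrite wE B1E' /= -catA.
  by rewrite /= walk_cat (walk_add 1 _ _ _ A1E) /= A2E.
by exists [::], w.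
Qed.

(** If one of [A], [A'] were a proper prefix of the other, the longer one would continue with a [D]
    from height 0. *)
Lemma walk_first_return_inj A A' B B' :
  A ++ D :: B = A' ++ D :: B' ->
  walk 0 A = Some 0 -> walk 0 A' = Some 0 -> A = A'.
Proof.
wlog le_AA : A A' B B' / size A <= size A'.
  move=> H; case: (leqP (size A) (size A')) => [/H|/ltnW/H] H' e a a'.
    exact: H' e a a'.
  by symmetry; apply: H' (esym e) a' a.
move=> e a a'; have := congr1 (take (size A)) e.
rewrite take_size_cat // takel_cat // => A_E.
have A'E : A' = A ++ drop (size A) A' by rewrite -[LHS](cat_take_drop (size A)) -A_E.
case X: (drop (size A) A') A'E => [|s X'] A'E; first by rewrite A'E cats0.
move: e a'; rewrite A'E -catA => /(congr1 (drop (size A))).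
rewrite !drop_size_cat //= => -[<- _].
by rewrite walk_cat a.
Qed.

(** The starting height stays general so that the induction can follow the path letter by letter. *)
Lemma walk_counts h w :
  walk h w = Some 0 <->
  count_mem D w = h + count_mem U w /\
  (forall j, count_mem D (take j w) <= h + count_mem U (take j w)).
Proof.
elim: w h => [|s w IH] h /=.
  by rewrite addn0; split=> [[->] //|[<-]].
have tk (Q : seq step -> Prop) :
    (forall j, Q (take j (s :: w))) <-> Q [::] /\ forall j, Q (s :: take j w).
  split=> [H|[H0 H]]; first by split=> [|j]; [exact: (H 0) | exact: (H j.+1)].
  by case.
rewrite (tk (fun x => count_mem D x <= h + count_mem U x)) /= leq0n.
case: s {tk} => /=.
  under eq_forall do rewrite add0n addnA addn1.
  by rewrite IH add0n addnA addn1; split=> -[e H]; split=> //; case: H.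
case: h => [|h]; first by split=> // -[_ [_ /(_ 0)]]; rewrite take0.
under eq_forall do rewrite add0n add1n addSn ltnS.
rewrite IH add0n add1n addSn; split=> [[-> H]|[[->] [_ H]]]; by split.
Qed.

Lemma dyckE k w : dyck k w <-> walk 0 w = Some 0 /\ size w = 2 * k.
Proof.
have szE : size w = count_mem U w + count_mem D w.
  by elim: w => //= -[] w -> /=; lia.
rewrite walk_counts szE /dyck /=; split=> [[cU cD H]|[[e H] sz]].
  by rewrite cU cD; split; [split=> // | lia].
by split=> //; lia.
Qed.

(** * Counting Dyck paths by ballot numbers *)

Fixpoint paths (n h : nat) : seq (seq step) :=
  if n is n'.+1 then
    map (cons U) (paths n' h.+1) ++
    (if h is h'.+1 then map (cons D) (paths n' h') else [::])
  else if h is 0 then [:: [::]] else [::].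

Lemma mem_paths n h w : (w \in paths n h) = (walk h w == Some 0) && (size w == n).
Proof.
have inj (s : step) : injective (cons s) by move=> ? ? [].
elim: n h w => [|n IH] h w /=.
  by case: w => [|s w]; rewrite ?andbF; case: h.
rewrite mem_cat; case: w => [|s w].
  rewrite andbF; apply/negbTE; rewrite negb_or; apply/andP; split.
    by apply/mapP => -[].
  by case: h => // h; apply/mapP => -[].
case: s.
  rewrite (mem_map (inj U)) IH /= eqSS orbC.
  case: h => [|h] //; suff /negbTE-> : U :: w \notin [seq D :: i | i <- paths n h] by [].
  by apply/mapP => -[].
have /negbTE-> /= : D :: w \notin [seq U :: i | i <- paths n h.+1].
  by apply/mapP => -[].
by case: h => // h; rewrite (mem_map (inj D)) IH.
Qed.

Lemma paths_uniq n h : uniq (paths n h).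
Proof.
have inj (s : step) : injective (cons s) by move=> ? ? [].
elim: n h => [|n IH] [|h] //=; first by rewrite cats0 map_inj_uniq.
rewrite cat_uniq !map_inj_uniq // !IH andbT /=.
by apply/hasPn => _ /mapP[w _ ->]; apply/mapP => -[].
Qed.

Lemma paths_lt n h : n < h -> paths n h = [::].
Proof. by elim: n h => [|n IH] [|h] //= lt_nh; rewrite !IH //; lia. Qed.

(** Ballot formula for paths with [j] up steps, written as a sum to avoid truncated subtraction. The
    two branches of [paths] match the two terms of Pascal's rule. *)
Lemma size_paths j h :
  size (paths (2 * j + h) h) + (if j is j'.+1 then 'C(2 * j + h, j') else 0)
  = 'C(2 * j + h, j).
Proof.
move nE: (2 * j + h) => n; elim: n j h nE => [|n IH] j h nE.
  by have [-> ->] : j = 0 /\ h = 0 by lia.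
rewrite /= size_cat size_map.
case: j nE => [|j] nE.
  case: h nE => [|h] nE; first by lia.
  by rewrite size_map paths_lt ?bin0 -?(bin0 n) -?(IH 0 h) //=; lia.
have := IH j h.+1; have -> : 2 * j + h.+1 = n by lia.
move=> /(_ erefl) IHU; move: (IH j.+1) => {IH}; case: h nE IHU => [|h] nE IHU.
  (* From height 0 only [U] is possible. Here [n = 2 * j + 1], and the equality of its two middle
     binomials makes up for the absent [D] branch. *)
  move=> _; have symC : 'C(n, j.+1) = 'C(n, j).
    by rewrite -bin_sub; [congr 'C(_, _)|]; lia.
  rewrite binS symC /=; case: j {nE symC} IHU => [|j] /=; rewrite ?bin0 ?binS; lia.
move=> /(_ h) IHD; rewrite size_map binS /=.
have {}IHD := IHD ltac:(lia).
case: j {nE} IHU IHD => [|j] /=; rewrite ?bin0 ?binS; lia.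
Qed.

(** The ratio of consecutive binomials turns the ballot difference at height 0 into the Catalan
    number. *)
Lemma size_paths0 k : size (paths (2 * k) 0) * k.+1 = 'C(2 * k, k).
Proof.
have := size_paths k 0; rewrite addn0; case: k => [|k]; first by rewrite !bin0; lia.
have := mul_bin_left (2 * k.+1) k; have -> : 2 * k.+1 - k = k.+2 by lia.
by move: (size _) 'C(_, k) 'C(_, k.+1) => x y z; nia.
Qed.

(** * Step profiles of words *)

Definition steps (w : seq nat) : seq step :=
  if w is x :: w' then pairmap (fun a b => if b < a then D else U) x w'
  else [::].

Definition profile (w : seq nat) : seq step := rev (steps w).

Lemma size_profile w : size (profile w) = (size w).-1.
Proof. by rewrite size_rev; case: w => //= x w; rewrite size_pairmap. Qed.

Lemma profile_cat w1 w2 : w1 != [::] -> w2 != [::] ->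
  profile (w1 ++ w2) =
  profile w2 ++ (if head 0 w2 < last 0 w1 then D else U) :: profile w1.
Proof.
case: w1 w2 => [|x w1] [|y w2] // _ _.
by rewrite /profile /= pairmap_cat /= rev_cat rev_cons cat_rcons.
Qed.

Lemma profile_rcons_max a w : w != [::] -> all (fun x => x < a) w ->
  profile (rcons w a) = U :: profile w.
Proof.
case: w => // x w _ ltw; rewrite -cats1 profile_cat //=.
have /ltnW : last x w < a by apply: (allP ltw); exact: mem_last.
by rewrite leqNgt => /negbTE->.
Qed.

(** Each step sits between two adjacent letters, so cutting the path there cuts the word. The cut
    comes after [(size B).+1] letters, since a nonempty word has one letter more than its profile
    has steps. *)
Lemma profile_split w A s B : profile w = A ++ s :: B ->
  exists w1 w2, [/\ [/\ w = w1 ++ w2, w1 != [::] & w2 != [::]],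
    profile w2 = A, profile w1 = B & s = (if head 0 w2 < last 0 w1 then D else U)].
Proof.
move=> e; have szw : size w = (size A + size B).+2.
  by have := size_profile w; rewrite e size_cat /= addnS; case: (size w) => //= ? ->.
have sz1 : size (take (size B).+1 w) = (size B).+1.
  by rewrite size_takel // szw ltnS leqW ?leq_addl.
have sz2 : size (drop (size B).+1 w) = (size A).+1.
  by rewrite size_drop szw -addSn -addnS addnK.
exists (take (size B).+1 w), (drop (size B).+1 w).
have n1 : take (size B).+1 w != [::] by rewrite -size_eq0 sz1.
have n2 : drop (size B).+1 w != [::] by rewrite -size_eq0 sz2.
move: e; rewrite -{1}(cat_take_drop (size B).+1 w) profile_cat // => /eqP.
rewrite eqseq_cat ?size_profile ?sz2 // => /andP[/eqP-> /eqP[<- <-]].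
by rewrite cat_take_drop size_profile sz1.
Qed.

(** * Profiles and preimages under stack-sorting *)

(** Induction along the decreasing binary tree of [v], which follows the recursion of
    [stack_sort_max]. *)
Lemma uniq_max_ind (P : seq nat -> Prop) :
  P [::] ->
  (forall a L R, uniq (L ++ a :: R) ->
     all (fun x => x < a) L -> all (fun x => x < a) R ->
     P L -> P R -> P (L ++ a :: R)) ->
  forall v, uniq v -> P v.
Proof.
move=> P0 PS v; have [m] := ubnP (size v); elim: m v => // m IH [|x v] // sz un.
have amax y : y \in x :: v -> y <= \max_(z <- x :: v) z.
  by move=> yv; apply: leq_bigmax_seq.
have ain := max_mem x v; move: sz un amax; move: (\max_(z <- x :: v) z) ain => a.
case/splitPr=> L R; rewrite size_cat /= addnS ltnS => sz un amax.
move: (un); rewrite cat_uniq /= negb_or => /and3P[uL /andP[aL _] /andP[aR uR]].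
apply: PS => //; last 1 first.
- by apply: IH => //; apply: leq_ltn_trans sz; apply: leq_addl.
- apply/allP => y yL; rewrite ltn_neqAle amax ?mem_cat ?yL // andbT.
  by apply: contraNneq aL => <-.
- apply/allP => y yR; rewrite ltn_neqAle amax ?mem_cat ?inE ?yR ?orbT // andbT.
  by apply: contraNneq aR => <-.
- by apply: IH => //; apply: leq_ltn_trans sz; apply: leq_addr.
Qed.

Lemma stack_sort_perm v : uniq v -> perm_eq (stack_sort v) v.
Proof.
move: v; apply: uniq_max_ind => // a L R _ ltL ltR pL pR.
by rewrite stack_sort_max // perm_cat // cats1 perm_rcons perm_cons.
Qed.

Lemma stack_sort_eq0 v : uniq v -> (stack_sort v == [::]) = (v == [::]).
Proof. by move=> /stack_sort_perm/perm_size e; rewrite -!size_eq0 e. Qed.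

Lemma all_stack_sort (p : pred nat) v :
  uniq v -> all p (stack_sort v) = all p v.
Proof. by move=> /stack_sort_perm/perm_all->. Qed.

Lemma uniq_cat_max (a : nat) L R : uniq (L ++ a :: R) -> uniq L /\ uniq R.
Proof. by rewrite cat_uniq /= => /and4P[]. Qed.

Lemma profile_stack_sort a L R : uniq (L ++ a :: R) ->
  all (fun x => x < a) L -> all (fun x => x < a) R ->
  L != [::] -> R != [::] ->
  profile (stack_sort (L ++ a :: R)) =
  U :: profile (stack_sort R) ++
    (if head 0 (stack_sort R) < last 0 (stack_sort L) then D else U)
    :: profile (stack_sort L).
Proof.
move=> un ltL ltR L0 R0; have [uL uR] := uniq_cat_max _ _ _ un.
rewrite stack_sort_max // catA cats1 profile_rcons_max.
- by rewrite profile_cat ?stack_sort_eq0.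
- by rewrite -size_eq0 size_cat addn_eq0 !size_eq0 stack_sort_eq0 ?(negbTE L0).
- by rewrite all_cat !all_stack_sort // ltL.
Qed.

(** The [U] contributed by the maximum pays for a possible [D] at the cut between the two sorted
    sides. *)
Lemma walk_stack_sort v : uniq v ->
  exists e, walk 0 (profile (stack_sort v)) = Some e.
Proof.
move: v; apply: uniq_max_ind => [|a L R un ltL ltR [eL IHL] [eR IHR]].
  by exists 0.
have [uL uR] := uniq_cat_max _ _ _ un.
case: (eqVneq L [::]) (un) => [-> _|L0 _].
  case: (eqVneq R [::]) => [->|R0]; first by exists 0.
  rewrite stack_sort_max //= cats1.
  rewrite profile_rcons_max ?stack_sort_eq0 ?all_stack_sort //=.
  by exists (eR + 1); apply: (walk_add 1 0).
case: (eqVneq R [::]) (un) => [-> _|R0 _].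
  rewrite stack_sort_max //= cats1.
  rewrite profile_rcons_max ?stack_sort_eq0 ?all_stack_sort //=.
  by exists (eL + 1); apply: (walk_add 1 0).
rewrite profile_stack_sort //= walk_cat (walk_add 1 _ _ _ IHR) addn1.
by case: ifP => _ /=; [exists (eL + eR) | exists (eL + eR.+2)]; apply: (walk_add _ 0).
Qed.

(* The first-return decomposition of the profile determines the cut between
   [stack_sort L] and [stack_sort R]. *)
Lemma walk_stack_sort_max a L R : uniq (L ++ a :: R) ->
  all (fun x => x < a) L -> all (fun x => x < a) R ->
  walk 0 (profile (stack_sort (L ++ a :: R))) = Some 0 ->
  L = [::] /\ R = [::] \/
  [/\ L != [::] /\ R != [::],
      profile (stack_sort (L ++ a :: R)) =
        U :: profile (stack_sort R) ++ D :: profile (stack_sort L),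
      walk 0 (profile (stack_sort L)) = Some 0 &
      walk 0 (profile (stack_sort R)) = Some 0].
Proof.
move=> un ltL ltR; have [uL uR] := uniq_cat_max _ _ _ un.
have [eL IHL] := walk_stack_sort L uL; have [eR IHR] := walk_stack_sort R uR.
case: (eqVneq L [::]) (un) => [-> _|L0 _].
  case: (eqVneq R [::]) => [->|R0]; first by left.
  rewrite stack_sort_max //= cats1.
  rewrite profile_rcons_max ?stack_sort_eq0 ?all_stack_sort //=.
  by rewrite (walk_add 1 _ _ _ IHR) addn1.
case: (eqVneq R [::]) (un) => [-> _|R0 _].
  rewrite stack_sort_max //= cats1.
  rewrite profile_rcons_max ?stack_sort_eq0 ?all_stack_sort //=.
  by rewrite (walk_add 1 _ _ _ IHL) addn1.
rewrite profile_stack_sort //= walk_cat (walk_add 1 _ _ _ IHR) addn1.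
case: ifP => _ /=; rewrite (walk_add _ _ _ _ IHL) => -[].
  by move/eqP; rewrite addn_eq0 => /andP[/eqP eL0 /eqP eR0]; right; rewrite IHL IHR eL0 eR0.
by rewrite addnS.
Qed.

(** The last letter of the image is the root of both trees, and the first return locates the cut
    between the two sorted sides; the sides are then compared by induction. *)
Lemma stack_sort_inj_dyck v v' : uniq v -> uniq v' ->
  walk 0 (profile (stack_sort v)) = Some 0 ->
  stack_sort v = stack_sort v' -> v = v'.
Proof.
move=> uv; move: v uv v'.
apply: uniq_max_ind => [|a L R un ltL ltR IHL IHR] v' uv'.
  by move=> _ /esym/eqP; rewrite stack_sort_eq0 // => /eqP.
(* The tree induction serves here only as a case analysis on [v']. *)
move: v' uv' {-2}v' (erefl v').
apply: uniq_max_ind => [|a' L' R' un' ltL' ltR' _ _] v' -> {v'} dyk e.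
  by move/eqP: e; rewrite stack_sort_eq0 // => /eqP.
have [uL uR] := uniq_cat_max _ _ _ un; have [uL' uR'] := uniq_cat_max _ _ _ un'.
have [aE eLR] : a = a' /\ stack_sort L ++ stack_sort R = stack_sort L' ++ stack_sort R'.
  move/eqP: e; rewrite !stack_sort_max // !catA !cats1 eqseq_rcons.
  by case/andP => /eqP-> /eqP->.
subst a'; have dyk' := dyk; rewrite e in dyk'.
case: (walk_stack_sort_max _ _ _ un ltL ltR dyk) => [[L0 R0]|[[L0 R0] pE dL dR]].
  move: eLR; rewrite L0 R0 /= => /esym/eqP; rewrite -size_eq0 size_cat addn_eq0.
  by rewrite !size_eq0 !stack_sort_eq0 // => /andP[/eqP-> /eqP->].
case: (walk_stack_sort_max _ _ _ un' ltL' ltR' dyk') => [[L0' R0']|[[L0' R0'] pE' dL' dR']].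
  move: eLR; rewrite L0' R0' /= => /eqP; rewrite -size_eq0 size_cat addn_eq0.
  by rewrite !size_eq0 !stack_sort_eq0 // (negbTE L0).
move: pE; rewrite e pE' => -[/esym pE].
(* Equal profiles give the right sides equal lengths, which is enough to align the two
   concatenations. *)
have pR := walk_first_return_inj _ _ _ _ pE dR dR'.
have szR : size (stack_sort R) = size (stack_sort R').
  have := congr1 size pR; rewrite !size_profile.
  by move: R0 R0'; rewrite -!(stack_sort_eq0 R) -?(stack_sort_eq0 R') //;
    case: (stack_sort R) => // ? ?; case: (stack_sort R') => //= ? ? _ _ ->.
have /andP[/eqP eL /eqP eR] : (stack_sort L == stack_sort L') && (stack_sort R == stack_sort R').
  rewrite -eqseq_cat ?eLR //; have := congr1 size eLR.
  by rewrite !size_cat szR => /addIn.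
by rewrite (IHL L') // (IHR R').
Qed.

Lemma stack_sort_last v y : uniq v -> y \in v -> y <= last 0 (stack_sort v).
Proof.
move=> uv; move: v uv y; apply: uniq_max_ind => // a L R _ ltL ltR _ _ y.
rewrite stack_sort_max // catA cats1 last_rcons mem_cat inE.
by case/or3P => [/(allP ltL)/ltnW|/eqP->|/(allP ltR)/ltnW].
Qed.

(** In the tree of [R], go from the root to the left child, or to the right one if there is no left
    child, down to a leaf. That leaf is the head of [stack_sort R]; every node on the way exceeds
    all of [L], so [L] can be hung to the left of the leaf. *)
Lemma stack_sort_merge L R : uniq (L ++ R) ->
  last 0 (stack_sort L) < head 0 (stack_sort R) ->
  exists2 v, uniq v & stack_sort v = stack_sort L ++ stack_sort R.
Proof.
move=> un; have /and3P[uL _ uR] : [&& uniq L, true & uniq R].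
  by move: un; rewrite cat_uniq => /and3P[-> _ ->].
move: R uR un.
apply: (uniq_max_ind (fun R => uniq (L ++ R) ->
  last 0 (stack_sort L) < head 0 (stack_sort R) ->
  exists2 v, uniq v & stack_sort v = stack_sort L ++ stack_sort R)) => //.
move=> a R1 R2 uR ltR1 ltR2 IH1 IH2 un lt_LR.
have [uR1 uR2] := uniq_cat_max _ _ _ uR.
have ltL : all (fun x => x < a) L.
  apply/allP => x xL; apply: leq_ltn_trans (stack_sort_last _ _ uL xL) _.
  apply: leq_trans lt_LR _; rewrite stack_sort_max //.
  have : all (fun x => x < a) (stack_sort R1) by rewrite all_stack_sort.
  case: (stack_sort R1) => [_|y s /= /andP[/ltnW]] //.
  have : all (fun x => x < a) (stack_sort R2) by rewrite all_stack_sort.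
  by case: (stack_sort R2) => [_|y s /= /andP[/ltnW]] //=.
have ext v w : uniq v -> uniq w -> stack_sort v = stack_sort L ++ stack_sort w ->
    all (fun x => x < a) w -> all (fun x => x < a) v.
  move=> uv uw e ltw; rewrite -all_stack_sort // e all_cat.
  by rewrite !all_stack_sort // ltL.
case: (eqVneq R1 [::]) un lt_LR => [->|R10] un lt_LR.
  case: (eqVneq R2 [::]) un lt_LR => [->|R20] un lt_LR.
    by exists (L ++ [:: a]) => //; rewrite !stack_sort_max.
  case: IH2 => [||v uv e].
  - by apply: subseq_uniq un; rewrite cat_subseq //; apply: subseq_cons.
  - by move: lt_LR; rewrite stack_sort_max //=; move: R20; rewrite -stack_sort_eq0 //; case: (stack_sort R2).
  have ltv := ext _ _ uv uR2 e ltR2; exists (v ++ [:: a]).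
    by rewrite cat_uniq uv /= orbF andbT; apply/negP => /(allP ltv); rewrite ltnn.
  by rewrite !stack_sort_max //= e catA.
case: IH1 => [||v uv e].
- by apply: subseq_uniq un; rewrite catA prefix_subseq.
- by move: lt_LR; rewrite stack_sort_max //=; move: R10; rewrite -stack_sort_eq0 //; case: (stack_sort R1).
have ltv := ext _ _ uv uR1 e ltR1; exists (v ++ a :: R2).
  rewrite (perm_uniq (s2 := L ++ R1 ++ a :: R2)) // catA perm_cat2r.
  by rewrite -(permPl (stack_sort_perm _ uv)) e perm_cat // stack_sort_perm.
by rewrite !stack_sort_max // e -catA.
Qed.

(* A preimage whose profile does not return to height 0 is never unique: an empty
   side can be exchanged with the other one, and at an ascent the two sides can
   be merged. *)
Lemma stack_sort_unique_or v : uniq v ->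
  walk 0 (profile (stack_sort v)) = Some 0 \/
  exists v', [/\ uniq v', v' != v & stack_sort v' = stack_sort v].
Proof.
move: v; apply: uniq_max_ind => [|a L R un ltL ltR IHL IHR]; first by left.
have [uL uR] := uniq_cat_max _ _ _ un.
have aL : a \notin L by apply/negP => /(allP ltL); rewrite ltnn.
have aR : a \notin R by apply/negP => /(allP ltR); rewrite ltnn.
have uniq_rcons w : uniq w -> all (fun x => x < a) w -> uniq (w ++ [:: a]).
  move=> uw ltw; rewrite cats1 rcons_uniq uw andbT.
  by apply/negP => /(allP ltw); rewrite ltnn.
case: (eqVneq L [::]) (un) => [-> _|L0 _].
  case: (eqVneq R [::]) => [->|R0]; first by left.
  right; exists (R ++ [:: a]); split; rewrite ?uniq_rcons //.
    by case: R R0 aR {ltR IHR uR un} => //= x R _; rewrite inE eq_sym eqseq_cons => /norP[/negbTE->].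
  by rewrite !stack_sort_max //= stack_sort_nil.
case: (eqVneq R [::]) (un) => [-> _|R0 _].
  right; exists (a :: L); split; rewrite /= ?aL ?uL //.
    by case: L L0 aL {ltL IHL uL un} => //= x L _; rewrite inE eqseq_cons => /norP[/negbTE->].
  by rewrite !stack_sort_max //= -(cat0s (a :: L)) stack_sort_max.
(* A second preimage of one side gives one of the whole word, so both sides may be assumed to return
   to height 0. *)
case: IHL => [dL|[L' [uL' neL eL]]]; last first.
  right; exists (L' ++ a :: R); have pL : perm_eq L' L.
    by rewrite -(permPl (stack_sort_perm _ uL')) eL stack_sort_perm.
  split; last by rewrite !stack_sort_max ?(perm_all _ pL) ?eL.
    by rewrite (perm_uniq (s2 := L ++ a :: R)) // perm_cat2r.
  by rewrite eqseq_cat ?(perm_size pL) // (negbTE neL).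
case: IHR => [dR|[R' [uR' neR eR]]]; last first.
  right; exists (L ++ a :: R'); have pR : perm_eq R' R.
    by rewrite -(permPl (stack_sort_perm _ uR')) eR stack_sort_perm.
  split; last by rewrite !stack_sort_max ?(perm_all _ pR) ?eR.
    by rewrite (perm_uniq (s2 := L ++ a :: R)) // perm_cat2l perm_cons.
  by rewrite eqseq_cat // eqseq_cons eqxx /= (negbTE neR) andbF.
rewrite profile_stack_sort //; case: ifPn => [_|].
  by left; rewrite /= walk_cat (walk_add 1 _ _ _ dR) /= dL.
rewrite -leqNgt leq_eqVlt => /orP[/eqP eq_LR|lt_LR]; last first.
  have uLR : uniq (L ++ R).
    by apply: subseq_uniq un; rewrite cat_subseq //; apply: subseq_cons.
  have [v uv e] := stack_sort_merge _ _ uLR lt_LR.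
  have ltv : all (fun x => x < a) v.
    by rewrite -all_stack_sort // e all_cat !all_stack_sort // ltL.
  (* This preimage ends in [a], whereas [L ++ a :: R] ends in a letter of [R]. *)
  right; exists (v ++ [:: a]); split; rewrite ?uniq_rcons //.
    apply: contra aR => /eqP/(congr1 (last a)).
    by rewrite !last_cat /= => ->; case: R R0 {ltR uR un lt_LR uLR e dR} => // x R _; apply: mem_last.
  by rewrite !stack_sort_max //= e catA.
(* The two letters at the cut come from [L] and from [R], so they cannot be equal. *)
exfalso.
have lL : last 0 (stack_sort L) \in L.
  rewrite -(perm_mem (stack_sort_perm _ uL)); move: L0; rewrite -stack_sort_eq0 //.
  by case: (stack_sort L) => // x s _; apply: mem_last.
have hR : head 0 (stack_sort R) \in R.
  rewrite -(perm_mem (stack_sort_perm _ uR)); move: R0; rewrite -stack_sort_eq0 //.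
  by case: (stack_sort R) => // x s _; apply: mem_head.
move: un; rewrite cat_uniq => /and3P[_ /hasPn /(_ (head 0 (stack_sort R)))].
by rewrite inE hR orbT -eq_LR lL => /(_ isT).
Qed.

(** * Characterization of uniquely sorted words *)

Lemma is_permutation_perm v w : perm_eq v w -> is_permutation v = is_permutation w.
Proof. by move=> p; rewrite /is_permutation (perm_uniq p) (perm_all _ p). Qed.

(** A preimage is a rearrangement of [w] and inherits positivity, so preimages may be sought among
    all duplicate-free words. *)
Lemma uniquely_sortedE w : is_permutation w ->
  uniquely_sorted w <->
  walk 0 (profile w) = Some 0 /\ exists2 v, uniq v & stack_sort v = w.
Proof.
move=> pw; have pv v : uniq v -> stack_sort v = w -> is_permutation v.
  by move=> uv vw; rewrite -(is_permutation_perm w) // -vw stack_sort_perm.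
split=> [[v [[/andP[uv _] vw] v_uniq]]|[dw [v uv vw]]].
  split; last by exists v.
  case: (stack_sort_unique_or v uv) => [|[v' [uv' /eqP nv' e]]]; first by rewrite vw.
  by case: nv'; rewrite (v_uniq v') // e vw; split=> //; apply: pv => //; rewrite e.
exists v; split; first by split=> //; apply: pv.
move=> v' [/andP[uv' _] v'w]; apply: stack_sort_inj_dyck => //; first by rewrite vw.
by rewrite v'w.
Qed.

(** * Pattern avoidance and existence of preimages *)

Lemma avoids_subseq u w t : subseq u w -> avoids w t -> avoids u t.
Proof. by move=> uw aw [x xu xt]; case: aw; exists x => //; apply: subseq_trans uw. Qed.

Lemma avoids312 w x y z : avoids w [:: 3; 1; 2] -> subseq [:: x; y; z] w ->
  y < z -> z < x -> False.
Proof.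
move=> aw sw yz zx; case: aw; exists [:: x; y; z] => //; split=> //.
by move=> [|[|[|i]]] [|[|[|j]]] //= _ _; lia.
Qed.

Lemma avoids231 w x y z : avoids w [:: 2; 3; 1] -> subseq [:: x; y; z] w ->
  z < x -> x < y -> False.
Proof.
move=> aw sw zx xy; case: aw; exists [:: x; y; z] => //; split=> //.
by move=> [|[|[|i]]] [|[|[|j]]] //= _ _; lia.
Qed.

(** The first return [U A D B] of the profile cuts [w] into [w1 ++ w2 ++ [:: a]], where [w2] has
    profile [A] and [w1] has profile [B]. With preimages [v1], [v2] from the induction hypothesis,
    [v1 ++ a :: v2] sorts to [w] because [a] is the maximum. *)
Lemma dyck_sorted w : uniq w -> avoids w [:: 3; 1; 2] ->
  walk 0 (profile w) = Some 0 -> exists2 v, uniq v & stack_sort v = w.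
Proof.
have [m] := ubnP (size w); elim: m w => // m IH w sz uw aw.
case pE: (profile w) => [|s p].
  move=> _; exists w => //; move: (size_profile w); rewrite pE.
  case: w {sz uw aw pE} => [|x [|y w]] // _.
  by rewrite -[in LHS](cat0s [:: x]) stack_sort_max.
case: s pE => //= pE /walk_first_return[A [B [pE' dA dB]]].
have [w' [w3 [[wE w'0 w30] p3 p' /esym]]] := profile_split w [::] U p pE.
case: ifP => // /negbT; rewrite -leqNgt => le_w'3 _.
have {}p3 : w3 = [:: last 0 w'] \/ exists2 a, w3 = [:: a] & last 0 w' <= a.
  move: (size_profile w3); rewrite p3; case: w3 w30 le_w'3 {wE p3} => [|a [|b w3]] //= _ le _.
  by right; exists a.
case: p3 => [w3E|[a w3E le_w'a]].
  exfalso; move: uw; rewrite wE w3E cats1 rcons_uniq.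
  by case: w' w'0 {wE le_w'3 p' w3E} => //= x w' _; rewrite mem_last.
(* The last letter [a] exceeds its predecessor [y], since the first step is [U]. A letter [x > a]
   further left would make [x y a] an occurrence of 312. *)
subst w3; have ltw' : all (fun x => x < a) w'.
  apply/allP => x xw'; rewrite ltnNge; apply/negP.
  rewrite leq_eqVlt => /orP[/eqP ax|lt_ax].
    by move: uw; rewrite wE cats1 rcons_uniq ax xw'.
  case/lastP: w' w'0 wE xw' le_w'a {le_w'3 p'} => // w' y _ wE.
  rewrite last_rcons mem_rcons inE => /orP[/eqP<-|xw'] le_ya; first by lia.
  have lt_ya : y < a.
    rewrite ltn_neqAle le_ya andbT; apply/eqP => ya; move: uw.
    by rewrite wE cats1 !rcons_uniq ya mem_rcons mem_head.
  apply: (avoids312 _ x y a aw) => //; rewrite wE cat_rcons.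
  by rewrite -[[:: x; y; a]]/([:: x] ++ [:: y; a]) cat_subseq ?sub1seq.
rewrite pE' in p'.
have [w1 [w2 [[w'E w10 w20] p2 p1 _]]] := profile_split _ _ _ _ p'.
have sub1 : subseq w1 w by rewrite wE w'E -catA prefix_subseq.
have sub2 : subseq w2 w.
  by rewrite wE w'E -catA; apply: subseq_trans (suffix_subseq w1 _); apply: prefix_subseq.
have szE : size w = (size w1 + size w2).+1 by rewrite wE w'E !size_cat addn1.
have [||||v1 uv1 e1] := IH w1; rewrite ?(subseq_uniq sub1) ?p1 //.
- by rewrite -ltnS; apply: leq_trans sz; rewrite szE !ltnS leq_addr.
- exact: avoids_subseq aw.
have [||||v2 uv2 e2] := IH w2; rewrite ?(subseq_uniq sub2) ?p2 //.
- by rewrite -ltnS; apply: leq_trans sz; rewrite szE !ltnS leq_addl.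
- exact: avoids_subseq aw.
move: ltw'; rewrite w'E all_cat => /andP[ltw1 ltw2].
have e : stack_sort (v1 ++ a :: v2) = w.
  by rewrite stack_sort_max -?(all_stack_sort _ v1) -?(all_stack_sort _ v2) ?e1 ?e2 // wE w'E catA.
exists (v1 ++ a :: v2) => //; rewrite -(perm_uniq (s1 := w)) // wE w'E -catA.
rewrite -e1 -e2; apply: perm_cat; first exact: stack_sort_perm.
by rewrite cats1 perm_rcons perm_cons stack_sort_perm.
Qed.

Lemma subseq_nth3 (w : seq nat) i j l : i < j -> j < l -> l < size w ->
  subseq [:: nth 0 w i; nth 0 w j; nth 0 w l] w.
Proof.
move=> lt_ij lt_jl lt_lw.
rewrite -{4}(mkseq_nth 0 w) -[[:: _; _; _]]/(map (nth 0 w) [:: i; j; l]) map_subseq //.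
(* An increasing list of positions is a filter of [iota], hence a subsequence of it. *)
rewrite (_ : [:: i; j; l] = filter (mem [:: i; j; l]) (iota 0 (size w))).
  exact: filter_subseq.
apply: (irr_sorted_eq ltn_trans ltnn).
- by rewrite /= lt_ij lt_jl.
- exact: (sorted_filter ltn_trans _ (iota_ltn_sorted _ _)).
by move=> t; rewrite mem_filter mem_iota /= !inE; lia.
Qed.

Lemma subseq3_nth (w : seq nat) x y z : subseq [:: x; y; z] w ->
  exists i j l, [/\ i < j, j < l & l < size w] /\
    [/\ nth 0 w i = x, nth 0 w j = y & nth 0 w l = z].
Proof.
rewrite -{1}(mkseq_nth 0 w) => /subseqP[m szm]; rewrite -map_mask => e.
have : all (gtn (size w)) (mask m (iota 0 (size w))).
  by apply/allP => t /mem_mask; rewrite mem_iota.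
have := sorted_mask ltn_trans m (iota_ltn_sorted 0 (size w)).
case: (mask m _) e => [|i [|j [|l [|? ?]]]] //= [-> -> ->] /and3P[ij jl _] /and4P[_ _ lw _].
by exists i, j, l.
Qed.

Lemma size_word n (p : 'S_n) : size (word p) = n.
Proof. by rewrite size_map size_enum_ord. Qed.

Lemma nth_word n (p : 'S_n) (i : 'I_n) : nth 0 (word p) i = (p i).+1.
Proof. by rewrite (nth_map i) ?size_enum_ord // nth_ord_enum. Qed.

Lemma word_permutation n (p : 'S_n) : is_permutation (word p).
Proof.
apply/andP; split; last by apply/allP => _ /mapP[i _ ->].
by rewrite map_inj_uniq ?enum_uniq // => i j [/val_inj/perm_inj].
Qed.

(** * Layered permutations and runs of descents *)

Definition layered (w : seq nat) : Prop :=
  avoids w [:: 2; 3; 1] /\ avoids w [:: 3; 1; 2].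

(** Positions are 0-based here: when [t.+1 < size w], this is membership of [t.+1] in [Des w]. *)
Definition descent (w : seq nat) (t : nat) : bool := nth 0 w t.+1 < nth 0 w t.

(** An ascent at [t] inside an inverted pair [i < j] gives a forbidden pattern: 312 at [i, t, t.+1]
    or at [i, t, j], or else 231 at [t, t.+1, j]. *)
Lemma layered_inversion w i j : uniq w -> layered w -> i < j -> j < size w ->
  nth 0 w j < nth 0 w i <-> forall t, i <= t < j -> descent w t.
Proof.
move=> uw [a231 a312] lt_ij lt_jw; split=> [inv t /andP[le_it lt_tj]|].
  rewrite /descent ltnNge; apply/negP => le_t.
  have neq u v : u < v -> v < size w -> nth 0 w u <> nth 0 w v.
    by move=> uv vw /eqP; rewrite nth_uniq ?(ltn_trans uv) //; lia.
  have no231 u v x : u < v -> v < x -> x < size w ->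
      nth 0 w x < nth 0 w u -> nth 0 w u < nth 0 w v -> False.
    by move=> uv vx xw; apply: (avoids231 w _ _ _ a231 (subseq_nth3 w u v x uv vx xw)).
  have no312 u v x : u < v -> v < x -> x < size w ->
      nth 0 w v < nth 0 w x -> nth 0 w x < nth 0 w u -> False.
    by move=> uv vx xw; apply: (avoids312 w _ _ _ a312 (subseq_nth3 w u v x uv vx xw)).
  have lt_t : nth 0 w t < nth 0 w t.+1.
    by rewrite ltn_neqAle le_t andbT; apply/eqP/neq => //; lia.
  case: (ltnP (nth 0 w t.+1) (nth 0 w i)) => [lt_ti|le_it1].
    have lt_it : i < t by rewrite ltn_neqAle le_it andbT; apply/eqP => it; move: lt_t lt_ti; rewrite it; lia.
    by apply: (no312 i t t.+1) => //; lia.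
  have lt_t1j : t.+1 < j.
    by rewrite ltn_neqAle lt_tj andbT; apply/eqP => tj; move: le_it1; rewrite tj; lia.
  case: (ltnP (nth 0 w j) (nth 0 w t)) => [lt_jt|le_tj].
    by apply: (no231 t t.+1 j) => //; lia.
  have lt_tj' : nth 0 w t < nth 0 w j.
    by rewrite ltn_neqAle le_tj andbT; apply/eqP/neq.
  have lt_it : i < t by rewrite ltn_neqAle le_it andbT; apply/eqP => it; move: inv; rewrite it; lia.
  by apply: (no312 i t j) => //; lia.
elim: j lt_ij {lt_jw} => // j IH; rewrite ltnS leq_eqVlt => /orP[/eqP<-|lt_ij] H.
  by apply: H; rewrite leqnn ltnSn.
apply: (@ltn_trans (nth 0 w j)); first by apply: H; rewrite (ltnW lt_ij) ltnSn.
by apply: IH => // t /andP[it tj]; apply: H; rewrite it (ltn_trans tj).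
Qed.

(** With 0-based values, [r i] is the number of positions carrying a smaller value, and inversions
    determine all comparisons. *)
Lemma perm_inversions_inj n (p q : 'S_n) :
  (forall i j : 'I_n, i < j -> (p j < p i) = (q j < q i)) -> p = q.
Proof.
move=> H; have rank (r : 'S_n) i : #|[set j | r j < r i]%SET| = r i :> nat.
  rewrite -(card_imset _ (@perm_inj _ r)).
  have -> : (r @: [set j | r j < r i] = [set x : 'I_n | x < r i])%SET.
    apply/setP => x; rewrite inE; apply/imsetP/idP => [[j]|lt_x].
      by rewrite inE => ? ->.
    by exists (r^-1 x)%g; rewrite ?inE permKV.
  rewrite -sum1dep_card (big_ord_narrow (ltnW (ltn_ord (r i)))).
  by rewrite sum1_card card_ord.
have {}H i j : (p j < p i) = (q j < q i).
  have neq (r : 'S_n) (x y : 'I_n) : x < y -> r x != r y :> nat.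
    by move=> xy; apply: contraTneq xy => /val_inj/perm_inj->; rewrite ltnn.
  case: (ltngtP i j) => [/H//|ij|/val_inj->]; last by rewrite !ltnn.
  have := H _ _ ij; have := neq p _ _ ij; have := neq q _ _ ij; lia.
apply/permP => i; apply: val_inj; rewrite /= -(rank p) -(rank q).
by congr #|pred_of_set _|; apply/setP => j; rewrite !inE H.
Qed.

(** [d t] is read as a link between positions [t] and [t.+1]; a run is a maximal chain of linked
    positions. *)
Fixpoint run_start (d : nat -> bool) (i : nat) : nat :=
  if i is i'.+1 then if d i' then run_start d i' else i else 0.

(** The search covers [i] to [n]; assuming [~~ d n] makes [n] a sentinel at which it stops. *)
Definition run_end (d : nat -> bool) (n i : nat) : nat :=
  i + find (fun t => ~~ d t) (iota i (n.+1 - i)).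

Definition is_run (d : nat -> bool) (a b : nat) : Prop :=
  [/\ a <= b, ~~ d b, 0 < a -> ~~ d a.-1 & forall t, a <= t < b -> d t].

Lemma is_run_eq d a b a' b' i : is_run d a b -> is_run d a' b' ->
  a <= i <= b -> a' <= i <= b' -> a = a' /\ b = b'.
Proof.
move=> [_ nb na H] [_ nb' na' H'] ai ai'; split; apply/eqP; rewrite eqn_leq.
  apply/andP; split; rewrite leqNgt; apply/negP => lt.
    by have /negP := na ltac:(lia); apply; apply: H'; lia.
  by have /negP := na' ltac:(lia); apply; apply: H; lia.
apply/andP; split; rewrite leqNgt; apply/negP => lt.
  by move/negP: nb'; apply; apply: H; lia.
by move/negP: nb; apply; apply: H'; lia.
Qed.

Lemma run_spec d n i : ~~ d n -> i <= n ->
  [/\ is_run d (run_start d i) (run_end d n i),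
      run_start d i <= i <= run_end d n i & run_end d n i <= n].
Proof.
move=> dn le_in.
have hasP : has (fun t => ~~ d t) (iota i (n.+1 - i)).
  by apply/hasP; exists n; rewrite ?mem_iota //; lia.
have lt_f : find (fun t => ~~ d t) (iota i (n.+1 - i)) < n.+1 - i.
  by move: hasP; rewrite has_find size_iota.
have := nth_find 0 hasP; rewrite nth_iota // => db.
have bf t : i <= t < run_end d n i -> d t.
  rewrite /run_end => it.
  have lt : t - i < find (fun t => ~~ d t) (iota i (n.+1 - i)) by lia.
  have := before_find 0 lt; rewrite nth_iota; last by lia.
  by rewrite subnKC; [move/negbFE | lia].
have le_a j : run_start d j <= j.
  by elim: j => //= j IH; case: ifP => // _; apply: leqW.
have sa j t : run_start d j <= t < j -> d t.
  elim: j => //= j IH; case: ifP => dj; last by lia.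
  by case: (eqVneq t j) => [->//|tj] ?; apply: IH; lia.
have na j : 0 < run_start d j -> ~~ d (run_start d j).-1.
  by elim: j => //= j IH; case: ifP => //= ->.
split; last by rewrite /run_end; lia.
  split; [by apply: leq_trans (le_a i) _; apply: leq_addr | exact: db | exact: na |].
  move=> t /andP[at_ tb]; case: (ltnP t i) => ti; first by apply: (sa i); rewrite at_.
  by apply: bf; rewrite ti.
by rewrite le_a leq_addr.
Qed.

(* Each maximal run of descents is reversed in place. *)
Lemma layered_exists n (d : nat -> bool) : ~~ d n ->
  exists p : 'S_n.+1, (p^-1)%g = p /\
    forall i j : 'I_n.+1, i < j ->
      p j < p i <-> forall t, i <= t < j -> d t.
Proof.
(* Reflection of [i] in its run. It stays in the run, so applying it twice gives back [i]. *)
move=> dn; pose q i := run_start d i + run_end d n i - i.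
have q_in i : i <= n -> run_start d i <= q i <= run_end d n i.
  by move=> /(run_spec d n i dn)[_ ? _]; rewrite /q; lia.
have q_le i : i <= n -> q i <= n.
  by move=> le_in; have [_ _] := run_spec d n i dn le_in; have := q_in i le_in; lia.
have q_run i j : i <= n -> run_start d i <= j <= run_end d n i ->
    run_start d j = run_start d i /\ run_end d n j = run_end d n i.
  move=> le_in ij; have [ri _ le_bn] := run_spec d n i dn le_in.
  have [|rj jj _] := run_spec d n j dn; first by lia.
  exact: is_run_eq rj ri jj ij.
have qK i : i <= n -> q (q i) = i.
  move=> le_in; have [e1 e2] := q_run i (q i) le_in (q_in i le_in).
  by have [_] := run_spec d n i dn le_in; rewrite {1}/q e1 e2 /q; lia.
pose f (i : 'I_n.+1) : 'I_n.+1 := inord (q i).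
have fE i : f i = q i :> nat by rewrite inordK // ltnS q_le // -ltnS.
have fK : involutive f by move=> i; apply: val_inj; rewrite /= !fE qK // -ltnS.
exists (perm (inv_inj fK)); split.
  by apply/permP => i; apply: (@perm_inj _ (perm (inv_inj fK))); rewrite permKV !permE fK.
move=> i j lt_ij; rewrite !permE !fE.
have le_in : i <= n by rewrite -ltnS.
have le_jn : j <= n by rewrite -ltnS.
have [[_ nb _ Hi] ini _] := run_spec d n i dn le_in.
have [[_ _ na Hj] inj _] := run_spec d n j dn le_jn.
case: (leqP j (run_end d n i)) => le_jb.
  have [|e1 e2] := q_run i j le_in; first by lia.
  split=> [_ t ijt|_]; first by apply: Hi; lia.
  by rewrite /q e1 e2; lia.
(* Across distinct runs the order is kept, and [d] fails at the end of the run of [i], which lies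
   between [i] and [j]. *)
have lt_ba : run_end d n i < run_start d j.
  by rewrite ltnNge; apply/negP => le; move/negP: nb; apply; apply: Hj; lia.
have := q_in i le_in; have := q_in j le_jn => qj qi.
split=> [|H]; first by lia.
by case/negP: nb; apply: H; lia.
Qed.

(** * Profiles of layered permutations and the map [DL] *)

Lemma nth_profile n (w : seq nat) i : size w = n.+1 -> i < n ->
  nth U (profile w) i = if descent w (n - i.+1) then D else U.
Proof.
case: w => // x w [szw] lt_in.
have le_n : n - i.+1 < n by lia.
by rewrite /profile nth_rev /= size_pairmap szw // (nth_pairmap 0) ?szw.
Qed.

(** If the outer pair of three positions is inverted, [d] holds throughout and both inner pairs are
    inverted too. In 231 the first inner pair is not inverted, and in 312 the second is not. *)
Lemma layered_inversions n (p : 'S_n.+1) (d : nat -> bool) :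
  (forall i j : 'I_n.+1, i < j -> p j < p i <-> forall t, i <= t < j -> d t) ->
  layered (word p) /\ forall t, t < n -> descent (word p) t = d t.
Proof.
move=> H; have Hw i j : i < j -> j < n.+1 ->
    nth 0 (word p) j < nth 0 (word p) i <-> forall t, i <= t < j -> d t.
  move=> lt_ij lt_jn; have := H (Ordinal (ltn_trans lt_ij lt_jn)) (Ordinal lt_jn) lt_ij.
  by rewrite -ltnS -!nth_word.
split; last first.
  move=> t lt_tn; apply/idP/idP => [/Hw -/(_ (ltnSn t) lt_tn)|dt].
    by apply; rewrite leqnn ltnSn.
  apply/Hw => // u; by rewrite ltnS -eqn_leq => /eqP<-.
split=> -[u su [szu]]; case: u szu su => [|x [|y [|z [|? ?]]]] // _;
  move=> /subseq3_nth[i [j [l [[ij jl]]]]];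
  rewrite size_word => ln [<- <- <-] ord.
- have /Hw li : nth 0 (word p) l < nth 0 (word p) i := ord 2 0 isT isT.
  have : nth 0 (word p) j < nth 0 (word p) i.
    by apply/Hw => //; [exact: ltn_trans ln | move=> t ?; apply: li => //; lia].
  have : nth 0 (word p) i < nth 0 (word p) j := ord 0 1 isT isT.
  lia.
- have /Hw li : nth 0 (word p) l < nth 0 (word p) i := ord 2 0 isT isT.
  have : nth 0 (word p) l < nth 0 (word p) j.
    by apply/Hw => // t ?; apply: li => //; lia.
  have : nth 0 (word p) j < nth 0 (word p) l := ord 1 2 isT isT.
  lia.
Qed.

Lemma layered_descents_inj n (p q : 'S_n.+1) :
  layered (word p) -> layered (word q) ->
  (forall t, t < n -> descent (word p) t = descent (word q) t) -> p = q.
Proof.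
move=> lp lq H; apply: perm_inversions_inj => i j lt_ij.
have up (r : 'S_n.+1) : uniq (word r) by case/andP: (word_permutation _ r).
have inv (r : 'S_n.+1) : layered (word r) ->
    r j < r i <-> forall t, i <= t < j -> descent (word r) t.
  move=> lr; rewrite -ltnS -!nth_word; apply: layered_inversion => //.
  by rewrite size_word.
have Hd t : i <= t < j -> descent (word p) t = descent (word q) t.
  by move=> ijt; apply: H; have := ltn_ord j; lia.
apply/idP/idP => [/(inv p lp) h|/(inv q lq) h]; apply/inv => // t ijt.
  by rewrite -Hd // h.
by rewrite Hd // h.
Qed.

(** The run-reversing involution with the same descents is layered, and a layered permutation is
    determined by its descents. *)
Lemma layered_involution n (p : 'S_n.+1) : layered (word p) -> (p^-1)%g = p.
Proof.
(* Past the last letter [nth] returns 0, so [descent (word p) n] holds; the conjunct [t < n] makes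
   [d] fail at [n]. *)
move=> lp; pose d t := (t < n) && descent (word p) t.
have [|q [qV qd]] := layered_exists n d; first by rewrite /d ltnn.
have [lq dq] := layered_inversions _ q d qd.
have -> // : p = q.
by apply: layered_descents_inj => // t lt_tn; rewrite dq // /d lt_tn.
Qed.

Lemma layered_profile_inj n (p q : 'S_n.+1) :
  layered (word p) -> layered (word q) -> profile (word p) = profile (word q) -> p = q.
Proof.
move=> lp lq e; apply: layered_descents_inj => // t lt_tn.
have := congr1 (fun s => nth U s (n - t.+1)) e.
have nt : n - (n - t.+1).+1 = t by lia.
rewrite !(nth_profile n) ?size_word ?nt; try lia.
by do 2 case: (descent _ t).
Qed.

Lemma layered_profile_surj n (s : seq step) : size s = n ->
  exists2 p : 'S_n.+1, layered (word p) & profile (word p) = s.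
Proof.
move=> szs; pose d t := (t < n) && (nth U s (n - t.+1) == D).
have [|p [_ pd]] := layered_exists n d; first by rewrite /d ltnn.
have [lp dp] := layered_inversions _ p d pd; exists p => //.
have szp : size (profile (word p)) = n by rewrite size_profile size_word.
apply: (@eq_from_nth _ U); rewrite szp // => i lt_in.
have lt_n : n - i.+1 < n by lia.
rewrite (nth_profile n) ?size_word // dp // /d lt_n /=.
have -> : n - (n - i.+1).+1 = i by lia.
by case: (nth U s i).
Qed.

(** Since [p] is an involution, [rot_word p] is the reversed word. Reversal turns ascents into
    descents at mirrored positions, and the opposite letter convention in the second component
    compensates for this. *)
Lemma DL_layered k (p : 'S_(2 * k).+1) : layered (word p) ->
  DL p = (profile (word p), profile (word p)).
Proof.
move=> lp; have szp : size (profile (word p)) = 2 * k by rewrite size_profile size_word.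
rewrite /DL /rot_word (layered_involution _ p lp); congr pair;
  apply: (@eq_from_nth _ U); rewrite size_map size_iota ?szp // => i lt_i;
  rewrite (nth_map 0) ?size_iota // nth_iota // add1n (nth_profile (2 * k)) ?size_word //.
  rewrite unfold_in /= size_word subSS /descent.
  have -> : 2 * k - i = (2 * k - i.+1).+1 by lia.
  by have -> : (2 * k - i.+1).+1 < (2 * k).+1 by lia.
rewrite unfold_in /= size_rev size_word !nth_rev ?size_word; try lia.
have -> : i.+1 < (2 * k).+1 by lia.
rewrite /descent /= !subSS.
have -> : 2 * k - i = (2 * k - i.+1).+1 by lia.
(* Distinct letters make a non-descent a strict ascent. *)
have : nth 0 (word p) (2 * k - i.+1) != nth 0 (word p) (2 * k - i.+1).+1.
  by rewrite nth_uniq ?size_word; try lia; case/andP: (word_permutation _ p).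
by case: ltngtP.
Qed.

Lemma uniquely_sorted_layeredE n (p : 'S_n) :
  uniquely_sorted_avoiding n [:: [:: 2; 3; 1]; [:: 3; 1; 2]] p <->
  layered (word p) /\ walk 0 (profile (word p)) = Some 0.
Proof.
have pp := word_permutation _ p; have /andP[up _] := pp.
rewrite /uniquely_sorted_avoiding /= uniquely_sortedE //.
split=> [[[dp _] av]|[[a231 a312] dp]].
  by split=> //; split; apply: av; rewrite !inE eqxx ?orbT.
split; first by split=> //; apply: dyck_sorted.
by move=> t; rewrite !inE => /orP[] /eqP->.
Qed.

(** * Bijection with the diagonal intervals and Catalan count *)

Theorem theorem9p2 (k : nat) :
  [/\ set_bij
        (uniquely_sorted_avoiding (2 * k).+1 [:: [:: 2; 3; 1]; [:: 3; 1; 2]])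
        (Int (dyck k) (@antichain_le (seq step)))
        (@DL k),
      Int (dyck k) (@antichain_le (seq step)) = [set (w, w) | w in dyck k] &
      (#|uniquely_sorted_avoiding (2 * k).+1
           [:: [:: 2; 3; 1]; [:: 3; 1; 2]]|%N%:R
       = 1 / k.+1%:R * 'C(2 * k, k)%:R :> rat)%R].
Proof.
set A := uniquely_sorted_avoiding _ _.
have AE p : A p <-> layered (word p) /\ walk 0 (profile (word p)) = Some 0.
  exact: uniquely_sorted_layeredE.
have szp (p : 'S_(2 * k).+1) : size (profile (word p)) = 2 * k.
  by rewrite size_profile size_word.
have dyck_profile p : A p -> dyck k (profile (word p)).
  by move=> /AE[_ dp]; apply/dyckE.
have profile_inj p q : A p -> A q -> profile (word p) = profile (word q) -> p = q.
  by move=> /AE[lp _] /AE[lq _]; apply: layered_profile_inj.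
have profile_surj w : dyck k w -> exists2 p, A p & profile (word p) = w.
  move=> /dyckE[dw szw]; have [p lp e] := layered_profile_surj _ w szw.
  by exists p => //; apply/AE; rewrite e.
have IntE : Int (dyck k) (@antichain_le (seq step)) = [set (w, w) | w in dyck k].
  apply/seteqP; split=> [[x y] /= [dx _ xy]|_ /= [w dw <-]]; last by split.
  by exists x => //; rewrite [y](esym xy).
split=> //.
- split=> [p Ap|p q|[x y]].
  + have [lp _] := (AE p).1 Ap; rewrite DL_layered // IntE.
    by exists (profile (word p)) => //; apply: dyck_profile.
  + rewrite !inE => Ap Aq; have [lp _] := (AE p).1 Ap; have [lq _] := (AE q).1 Aq.
    by rewrite !DL_layered // => -[/(profile_inj p q Ap Aq)].
  + rewrite IntE => -[w /profile_surj[p Ap e] [<- <-]]; exists p => //.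
    by have [lp _] := (AE p).1 Ap; rewrite DL_layered // e.
(* The profile maps [A] bijectively onto the duplicate-free list [paths (2 * k) 0], whose length is
   the Catalan number. *)
have cardA : #|A| = size (paths (2 * k) 0).
  rewrite cardE -(size_map (fun p : 'S_(2 * k).+1 => profile (word p))).
  apply/perm_size/uniq_perm; last 1 first.
  - move=> w; rewrite mem_paths; apply/mapP/andP => [[p]|[/eqP dw /eqP szw]].
      rewrite mem_enum inE => Ap ->; rewrite szp; split=> //.
      by have [_ ->] := (AE p).1 Ap.
    have [p Ap e] := profile_surj w ((dyckE k w).2 (conj dw szw)).
    by exists p => //; rewrite mem_enum inE.
  - rewrite map_inj_in_uniq ?enum_uniq // => p q; rewrite !mem_enum !inE.
    exact: profile_inj.
  - exact: paths_uniq.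
rewrite cardA -size_paths0 GRing.natrM GRing.div1r GRing.mulrC GRing.mulfK //.
by rewrite Num.Theory.pnatr_eq0.
Qed.
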